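(* Let $k\ge 1$, let $p_1,\dots,p_s$ be distinct primes and let $m_1,\dots,m_s\ge1$ be integers. Let $M_j$ be the set of partitions with at most $m_j$ parts, and let $M=M_1\times\cdots\times M_s$. For $\mu\in M$ write $\mu^j$ for its $j$th entry, a partition consisting of non-negative integers $\mu^j_1\ge\cdots\ge\mu^j_{m_j}$. Suppose we have non-negative reals $x_{\mu(1),\dots,\mu(k)}$ and $y_{\mu(1),\dots,\mu(k)}$ for each $k$-tuple $(\mu(1),\dots,\mu(k))\in M^k$. Suppose further that for all $\lambda(1),\dots,\lambda(k)\in M$, $$\sum_{\mu(1),\dots,\mu(k)\in M}x_{\mu(1),\dots,\mu(k)}\prod_{j=1}^s\prod_{\ell=1}^kp_j^{\sum_i\lambda(\ell)^j_i\mu(\ell)^j_i}=\sum_{\mu(1),\dots,\mu(k)\in M}y_{\mu(1),\dots,\mu(k)}\prod_{j=1}^s\prod_{\ell=1}^kp_j^{\sum_i\lambda(\ell)^j_i\mu(\ell)^j_i}=C_{\lambda(1),\dots,\lambda(k)},$$ where the reals $C_{\lambda(1),\dots,\lambda(k)}$ satisfy the growth condition $$C_{\lambda(1),\dots,\lambda(k)}\le\prod_{j=1}^sF_k^{m_j}\,p_j^{\frac{1-c_k}{2}\sum_i\left(\sum_{\ell=1}^k\lambda(\ell)^j_i\right)^2}$$ for some constants $F_k>0$ and $0<c_k<1$ depending on $k$. Then for all $\mu(1),\dots,\mu(k)\in M$, $$x_{\mu(1),\dots,\mu(k)}=y_{\mu(1),\dots,\mu(k)}.$$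
   Context: A partition with at most $m$ parts is a weakly decreasing sequence of $m$ non-negative integers. The sums over $i$ attached to the index $j$ run over $1\le i\le m_j$. *)

(* Defs.v *)
From mathcomp Require Import all_boot all_order all_algebra.
From mathcomp Require Import all_classical all_reals all_analysis.

Set Implicit Arguments.
Unset Strict Implicit.
Unset Printing Implicit Defensive.

Definition partition_le (m : nat) := {t : m.-tuple nat | sorted geq t}.

Definition part (m : nat) (mu : partition_le m) (i : 'I_m) : nat :=
  tnth (val mu) i.

Definition partition_prod (s : nat) (m : 'I_s -> nat) :=
  {dffun forall j : 'I_s, partition_le (m j)}.

Definition partition_family (s : nat) (m : 'I_s -> nat) (k : nat) :=
  {ffun 'I_k -> partition_prod m}.

(* Main.v *)
Require Import Defs.
From mathcomp Require Import all_boot all_order all_algebra.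
From mathcomp Require Import all_classical all_reals all_analysis.
From mathcomp Require Import ring lra.

(** The parts [mu l j i] are determined one at a time, for each [(l, j)] from
    the largest part downwards.  Once some initial parts are fixed to those of
    a reference family, raising by [d] the entries [lam l j i'], [i' <= i],
    keeps [lam l j] weakly decreasing and multiplies the remaining weight by
    [p_j ^ (d * mu l j i)].  So the masses of the fibres of
    [mu |-> mu l j i] form a measure on [nat] whose moments
    [M d = \sum_n u_n q ^ (d n)] are prescribed.  They satisfy
    [M d <= K * q ^ (a d^2 + b d)] with [a < 1/2]: for [i = 0] this is the growth
    condition, and for [i > 0] the part is bounded by the preceding fixed part.
    Such a measure is determined by its moments: if [w] is the difference of two
    of them and [f] is the product of the [z - q ^ j] over [j <= N], [j != n],
    then [\sum_i w_i f(q ^ i) = 0] gives [|w_n f(q ^ n)| <= 2 M N], while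
    [|f(q ^ n)|] is of order [q ^ (N ^ 2 / 2)] up to factors exponential in [N]. *)

Set Implicit Arguments.
Unset Strict Implicit.
Unset Printing Implicit Defensive.

Import Order.TTheory GRing.Theory Num.Theory.
Import numFieldNormedType.Exports.
Local Open Scope classical_set_scope.
Local Open Scope ring_scope.

(** * Determinacy of a measure on the powers of [q] by its moments *)

Lemma nneseries_cvg_series (R : realType) (u : nat -> R) (l : R) :
  (forall n, 0 <= u n) ->
  (\sum_(0 <= n <oo) (u n)%:E = l%:E)%E -> series u @ \oo --> l.
Proof.
move=> u0 ul.
have := @is_cvg_nneseries R (EFin \o u) xpredT 0 (fun n _ _ => u0 n).
rewrite /= ul; move/fine_cvg; apply: cvg_trans.
by apply: near_eq_cvg; near=> n; rewrite /= /series /= sumEFin.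
Unshelve. all: by end_near. Qed.

(** A factor [q ^+ n - q ^+ j] turns the series of order [d] into the series of order [d.+1] minus
    [q ^+ j] times that of order [d]. The induction on [js] therefore needs all [d] at once. *)
Lemma cvg_series_mul_nodes (R : realType) (q : R) (w : nat -> R) (js : seq nat) :
  (forall d, series (fun n => w n * q ^+ (d * n)) @ \oo --> (0 : R)) ->
  forall d, series (fun n => w n * q ^+ (d * n)
    * \prod_(j <- js) (q ^+ n - q ^+ j)) @ \oo --> (0 : R).
Proof.
move=> w0; elim: js => [|j js IH] d.
  apply: cvg_trans (w0 d); apply: near_eq_cvg; near=> n.
  by apply: eq_bigr => i _; rewrite big_nil mulr1.
pose v e n := w n * q ^+ (e * n) * \prod_(j <- js) (q ^+ n - q ^+ j).
have h : series (v d.+1) n - q ^+ j * series (v d) n @[n --> \oo] --> 0 - q ^+ j * 0.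
  apply: cvgB; first exact: IH.
  by apply: cvgM; [exact: cvg_cst | exact: IH].
rewrite mulr0 subr0 in h; apply: cvg_trans h; apply: near_eq_cvg; near=> n.
rewrite /series /= /v mulr_sumr -sumrB; apply: eq_bigr => i _.
by rewrite big_cons mulSn exprD; ring.
Unshelve. all: by end_near. Qed.

(** Two distinct powers of [q] differ by at least the fraction [1 - q^-1] of the larger one, which
    is at least [q ^+ j]. *)
Lemma node_distance (R : realType) (q : R) (n j : nat) : 1 < q -> j != n ->
  q ^+ j * (1 - q^-1) <= `|q ^+ n - q ^+ j|.
Proof.
move=> q1 jn; have q0 : 0 < q by rewrite (lt_trans ltr01).
have q1' := ltW q1.
have qV : q^-1 <= 1 by rewrite invf_le1.
have gap (a b : nat) : (a < b)%N -> q ^+ b * (1 - q^-1) <= q ^+ b - q ^+ a.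
  move=> ab; rewrite mulrBr mulr1 lerB// ler_pdivlMr// -exprSr.
  exact: ler_weXn2l.
case: (ltngtP j n) jn => [jn|nj|_] // _.
- rewrite (le_trans _ (ler_norm _))// (le_trans _ (gap _ _ jn))//.
  by rewrite ler_wpM2r ?subr_ge0// ler_weXn2l// ltnW.
- by rewrite distrC (le_trans _ (ler_norm _))// gap.
Qed.

Lemma count_neq_iota (n N : nat) : (n <= N)%N ->
  count (fun j => j != n) (iota 0 N.+1) = N.
Proof.
move=> nN; have := count_predC (pred1 n) (iota 0 N.+1).
by rewrite count_uniq_mem ?iota_uniq// mem_iota ltnS nN size_iota add1n => -[].
Qed.

(** The exponent is [0 + 1 + ... + N] without the term [n]; each of the [N] factors is bounded below
    by [node_distance]. *)
Lemma prod_nodes_lower (R : realType) (q : R) (n N : nat) : 1 < q -> (n <= N)%N ->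
  (1 - q^-1) ^+ N * q `^ (N%:R ^+ 2 / 2 + N%:R / 2 - n%:R)
  <= `|\prod_(j <- iota 0 N.+1 | j != n) (q ^+ n - q ^+ j)|.
Proof.
move=> q1 nN; have q0 : 0 < q by rewrite (lt_trans ltr01).
have qV : 0 <= 1 - q^-1 by rewrite subr_ge0 invf_le1// ltW.
have -> : (1 - q^-1) ^+ N * q `^ (N%:R ^+ 2 / 2 + N%:R / 2 - n%:R)
  = \prod_(j <- iota 0 N.+1 | j != n) (q ^+ j * (1 - q^-1)).
  rewrite big_split /= mulrC; congr (_ * _); last first.
    by rewrite big_const_seq iter_mulr_1 count_neq_iota.
  (* Multiplying by [q ^+ n] restores the missing factor, so that the product runs over all of
     [iota 0 N.+1] and yields to induction on [N]. *)
  apply: (@mulIf _ (q ^+ n)); first by rewrite expf_neq0// gt_eqF.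
  rewrite [RHS]mulrC -[_ :: iota 1 N]/(iota 0 N.+1).
  rewrite -(bigD1_seq n) ?iota_uniq ?mem_iota// -powR_mulrn 1?ltW//.
  rewrite -powRD ?(gt_eqF q0) ?implybT// subrK.
  elim: N {nN} => [|N IH].
    by rewrite big_seq1 expr0n /= !mul0r addr0 powRr0.
  rewrite -[N.+2]addn1 iotaD big_cat /= -IH big_seq1 -powR_mulrn 1?ltW//.
  rewrite -powRD ?(gt_eqF q0) ?implybT//; congr (_ `^ _).
  by rewrite add0n -natr1; field.
rewrite normr_prod; apply: ler_prod => j jn.
by rewrite node_distance// mulr_ge0// exprn_ge0// ltW.
Qed.

Lemma quadratic_le_linear (R : realType) (e b : R) : 0 < e ->
  \forall N \near \oo, - e * N%:R ^+ 2 + b * N%:R <= - N%:R.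
Proof.
move=> e0; near=> N.
have : (b + 1) / e <= N%:R by near: N; exact: nbhs_infty_ger.
rewrite ler_pdivrMr// => bN.
have : (b + 1) * N%:R <= N%:R * e * N%:R by rewrite ler_wpM2r.
by rewrite expr2; lra.
Unshelve. all: by end_near. Qed.

Lemma moment_determinacy (R : realType) (q a b K : R) (u v M : nat -> R) :
  1 < q -> 0 <= K -> a < 1 / 2 ->
  (forall n, 0 <= u n) -> (forall n, 0 <= v n) ->
  (forall d, \sum_(0 <= n <oo) (u n * q ^+ (d * n))%:E = (M d)%:E)%E ->
  (forall d, \sum_(0 <= n <oo) (v n * q ^+ (d * n))%:E = (M d)%:E)%E ->
  (forall d, M d <= K * q `^ (a * d%:R ^+ 2 + b * d%:R)) ->
  u =1 v.
Proof.
move=> q1 K0 a12 u0 v0 uM vM MK n.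
have q0 : 0 < q by rewrite (lt_trans ltr01).
have q1' := ltW q1.
have qV : 0 < 1 - q^-1 by rewrite subr_gt0 invf_lt1.
have uq0 d i : 0 <= u i * q ^+ (d * i) by rewrite mulr_ge0// exprn_ge0// ltW.
have vq0 d i : 0 <= v i * q ^+ (d * i) by rewrite mulr_ge0// exprn_ge0// ltW.
have part_le (z : nat -> R) d T : (forall i, 0 <= z i * q ^+ (d * i)) ->
    (\sum_(0 <= i <oo) (z i * q ^+ (d * i))%:E = (M d)%:E)%E ->
    \sum_(0 <= i < T) z i * q ^+ (d * i) <= M d.
  move=> z0 zM; rewrite -lee_fin -zM -sumEFin.
  by apply: nneseries_lim_ge => i _ _; rewrite lee_fin.
pose w i := u i - v i.
have w_cvg d : series (fun i => w i * q ^+ (d * i)) @ \oo --> (0 : R).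
  have h : series (fun i => u i * q ^+ (d * i)) T
      - series (fun i => v i * q ^+ (d * i)) T @[T --> \oo] --> M d - M d.
    by apply: cvgB; apply: nneseries_cvg_series.
  rewrite subrr in h; apply: cvg_trans h; apply: near_eq_cvg; near=> T.
  by rewrite /series /= -sumrB; apply: eq_bigr => i _; rewrite mulrBl.
have key N : (n <= N)%N ->
    `|w n| * ((1 - q^-1) ^+ N * q `^ (N%:R ^+ 2 / 2 + N%:R / 2 - n%:R))
    <= M N + M N.
  move=> nN.
  pose f i := \prod_(j <- iota 0 N.+1 | j != n) (q ^+ i - q ^+ j).
  apply: (@le_trans _ _ (`|w n| * `|f n|)).
    by rewrite ler_wpM2l// prod_nodes_lower.
  have [js fE] : exists js : seq nat,
      forall i, \prod_(j <- js) (q ^+ i - q ^+ j) = f i.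
    by exists [seq j <- iota 0 N.+1 | j != n] => i; rewrite big_filter.
  have wf := cvg_series_mul_nodes js w_cvg 0.
  (* The series tends to 0, so [w n * f n] is controlled by the partial sums with their [n]-th term
     removed. *)
  have fwf : `|w n * f n - series (fun i => w i * q ^+ (0 * i)
      * \prod_(j <- js) (q ^+ i - q ^+ j)) T| @[T --> \oo] --> `|w n * f n - 0|.
    by apply: cvg_norm; apply: cvgB => //; exact: cvg_cst.
  rewrite -normrM -[w n * f n]subr0.
  apply: cvgr_to_le fwf _; near=> T.
  have nT : (N < T)%N by near: T; exact: nbhs_infty_gt.
  rewrite /series /= (bigD1_seq n) ?iota_uniq//=; last first.
    by rewrite mem_index_iota (leq_ltn_trans nN).
  rewrite mul0n expr0 mulr1 fE opprD addrA subrr add0r normrN.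
  rewrite (le_trans (ler_norm_sum _ _ _))//.
  (* For [i <= N], [i != n], the product [f i] contains a zero factor. For [i > N] its [N] factors
     lie between 0 and [q ^+ i], so [f i] is at most [q ^+ (N * i)] and the [N]-th moments take
     over. *)
  apply: (@le_trans _ _ (\sum_(0 <= i < T) (u i * q ^+ (N * i) + v i * q ^+ (N * i)))).
    rewrite [leRHS](bigD1_seq n)/= ?iota_uniq ?mem_index_iota ?(leq_ltn_trans nN)//.
    rewrite ler_wpDl ?addr_ge0//; apply: ler_sum => i ni.
    rewrite mulr1 fE -mulrDl normrM ler_pM//.
      by rewrite (le_trans (ler_normB _ _))// !ger0_norm.
    have [iN|Ni] := leqP i N.
      rewrite /f (big_rem i) ?mem_iota ?ltnS// ni subrr /= mul0r normr0.
      by rewrite exprn_ge0// ltW.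
    rewrite /f normr_prod mulnC exprM.
    have -> : (q ^+ i) ^+ N = \prod_(j <- iota 0 N.+1 | j != n) q ^+ i.
      by rewrite big_const_seq count_neq_iota// iter_mulr_1.
    rewrite big_seq_cond [leRHS]big_seq_cond; apply: ler_prod => j /andP[].
    rewrite mem_iota ltnS /= => jN _; rewrite normr_ge0 ger0_norm.
      by rewrite gerBl exprn_ge0// ltW.
    by rewrite subr_ge0 ler_weXn2l// (leq_trans jN)// ltnW.
  by rewrite big_split lerD// part_le.
(* As a power of [q], the constant [1 - q^-1] only adds a linear term [r * N] to the exponent. *)
have [r rq] : exists r, 1 - q^-1 = q `^ r.
  exists (ln (1 - q^-1) / ln q); rewrite /powR gt_eqF// divfK ?lnK//.
  by rewrite gt_eqF// ln_gt0.
have wle : \forall N \near \oo, `|w n| <= (K + K) * q `^ n%:R * q^-1 ^+ N.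
  have e0 : 0 < 1 / 2 - a by rewrite subr_gt0.
  near=> N.
  have nN : (n <= N)%N by near: N; exact: nbhs_infty_ge.
  (* The left side, plus [n], is the exponent left after dividing the moment bound by the lower
     bound on the nodes; [a < 1 / 2] makes it tend to minus infinity. *)
  have : - (1 / 2 - a) * N%:R ^+ 2 + (b - 1 / 2 - r) * N%:R <= - N%:R.
    by near: N; exact: quadratic_le_linear.
  move=> hN; have := le_trans (key _ nN) (lerD (MK N) (MK N)).
  rewrite rq -[(q `^ r) ^+ N]powR_mulrn ?powR_ge0// -powRrM -powRD ?(gt_eqF q0) ?implybT//.
  rewrite -ler_pdivlMr ?powR_gt0// => /le_trans; apply.
  rewrite -mulrDl -!mulrA ler_wpM2l ?addr_ge0// -powRN.
  rewrite -[q^-1]powR_inv1 ?(ltW q0)// -[(q `^ -1) ^+ N]powR_mulrn ?powR_ge0// -powRrM.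
  rewrite -!powRD ?(gt_eqF q0) ?implybT// ler_powR//.
  by move: hN; set x := N%:R; set y := n%:R; lra.
have w0 : `|w n| <= 0.
  have g : (K + K) * q `^ n%:R * q^-1 ^+ N @[N --> \oo] --> (0 : R).
    apply: (@cvg_geometric R _ q^-1).
    by rewrite ger0_norm ?invr_ge0 ?(ltW q0)// invf_lt1.
  by apply: cvgr_to_ge g wle.
by move: w0; rewrite normr_le0 subr_eq0 => /eqP.
Unshelve. all: by end_near. Qed.

(** * Sums over fibres and their moments *)

Lemma subset_le_esum (R : realType) (T : choiceType) (A B : set T) (a : T -> \bar R) :
  A `<=` B -> (\esum_(t in A) a t <= \esum_(t in B) a t)%E.
Proof.
move=> AB; apply: le_ereal_sup => _ [F [Ffin FA] <-].
by exists F => //; split => //; exact: subset_trans AB.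
Qed.

(** Scaling finite subsums gives one inequality; the same inequality for [c^-1] and the scaled
    family gives the other. The case [c = 0] is separate, as the sum may be infinite. *)
Lemma esumZl (R : realType) (T : choiceType) (S : set T) (c : R) (a : T -> R) :
  0 <= c -> (forall t, 0 <= a t) ->
  (\esum_(t in S) (c * a t)%:E = c%:E * \esum_(t in S) (a t)%:E)%E.
Proof.
have half (d : R) (e : T -> R) : 0 <= d -> (forall t, 0 <= e t) ->
    (\esum_(t in S) (d * e t)%:E <= d%:E * \esum_(t in S) (e t)%:E)%E.
  move=> d0 e0; apply: ge_ereal_sup => _ [F SF <-].
  under eq_fsbigr do rewrite EFinM.
  rewrite -ge0_mule_fsumr; last by move=> t; rewrite lee_fin.
  by apply: lee_wpmul2l; [rewrite lee_fin|apply: ereal_sup_ubound; exists F].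
rewrite le_eqVlt => /predU1P[<- a0|c0 a0].
  by rewrite mul0e esum1// => t _; rewrite mul0r.
apply/eqP; rewrite eq_le (half _ _ (ltW c0) a0) /=.
rewrite -lee_pdivlMl//.
have := @half c^-1 (fun t => c * a t).
rewrite invr_ge0 ltW// => /(_ isT); under eq_esum do rewrite mulKf ?gt_eqF//.
by apply => t; rewrite mulr_ge0// ltW.
Qed.

(** This is the push-forward of the weights [Z] along [g]. The fibres partition [S], and their
    masses are finite because the moment of order 0 bounds them. *)
Lemma fiber_moments (R : realType) (T : choiceType) (S : set T) (g : T -> nat)
    (q : R) (Z : T -> R) (M : nat -> R) :
  0 <= q -> (forall t, 0 <= Z t) ->
  (forall d, \esum_(t in S) (Z t * q ^+ (d * g t))%:E = (M d)%:E)%E ->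
  exists u : nat -> R, [/\ forall n, 0 <= u n,
    forall n, (\esum_(t in S `&` g @^-1` [set n]) (Z t)%:E = (u n)%:E)%E &
    forall d, (\sum_(0 <= n <oo) (u n * q ^+ (d * n))%:E = (M d)%:E)%E].
Proof.
move=> q0 Z0 ZM.
pose fiber n := S `&` g @^-1` [set n].
have fin n : (\esum_(t in fiber n) (Z t)%:E \is a fin_num)%E.
  rewrite ge0_fin_numE ?esum_ge0//; last by move=> t _; rewrite lee_fin.
  apply: (@le_lt_trans _ _ (M 0%N)%:E); last exact: ltry.
  rewrite -ZM; under [leRHS]eq_esum do rewrite mul0n expr0 mulr1.
  by apply: subset_le_esum => t [].
exists (fun n => fine (\esum_(t in fiber n) (Z t)%:E)); split.
- by move=> n; rewrite fine_ge0// esum_ge0// => t _; rewrite lee_fin.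
- by move=> n; rewrite fineK.
move=> d; rewrite -ZM.
have -> : S = \bigcup_n fiber n.
  by apply/seteqP; split => [t St|t [n _ []]//]; exists (g t).
rewrite nneseries_sum_bigcup; last 2 first.
- by move=> i j _ _ [t [[_ /= <-] [_ /= <-]]].
- by move=> t; rewrite lee_fin mulr_ge0// exprn_ge0.
apply: eq_eseriesr => n _.
rewrite EFinM fineK// muleC -esumZl ?exprn_ge0//.
by apply: eq_esum => t [_ /= ->]; rewrite mulrC.
Qed.

Lemma fiber_determinacy (R : realType) (T : choiceType) (S : set T)
    (g : T -> nat) (q a b K : R) (X Y : T -> R) (M : nat -> R) :
  1 < q -> 0 <= K -> a < 1 / 2 ->
  (forall t, 0 <= X t) -> (forall t, 0 <= Y t) ->
  (forall d, \esum_(t in S) (X t * q ^+ (d * g t))%:E = (M d)%:E)%E ->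
  (forall d, \esum_(t in S) (Y t * q ^+ (d * g t))%:E = (M d)%:E)%E ->
  (forall d, M d <= K * q `^ (a * d%:R ^+ 2 + b * d%:R)) ->
  forall n, (\esum_(t in S `&` g @^-1` [set n]) (X t)%:E =
             \esum_(t in S `&` g @^-1` [set n]) (Y t)%:E)%E.
Proof.
move=> q1 K0 a12 X0 Y0 XM YM MK n.
have q0 : 0 <= q by rewrite ltW// (lt_trans ltr01).
have [u [u0 -> uM]] := fiber_moments q0 X0 XM.
have [v [v0 -> vM]] := fiber_moments q0 Y0 YM.
by rewrite (moment_determinacy q1 K0 a12 u0 v0 uM vM MK).
Qed.

(** * Partitions, partially fixed families and their remaining weights *)

Lemma part_antitone (m : nat) (mu : partition_le m) (i j : 'I_m) :
  (i <= j)%N -> (part mu j <= part mu i)%N.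
Proof.
move=> ij; rewrite /part !(tnth_nth 0%N).
have geq_trans : transitive geq by move=> x y z /= xy yz; exact: leq_trans yz xy.
have := sorted_leq_nth geq_trans leqnn 0%N (valP mu).
by apply; rewrite ?inE ?size_tuple.
Qed.

Lemma part_inj (m : nat) (mu nu : partition_le m) :
  (forall i, part mu i = part nu i) -> mu = nu.
Proof. by move=> e; apply/val_inj/eq_from_tnth => i; exact: e. Qed.

Lemma raise_partition (m : nat) (r d : nat) (mu : partition_le m) :
  {nu : partition_le m |
    forall i, part nu i = (part mu i + if (i <= r)%N then d else 0)%N}.
Proof.
pose t := [tuple (part mu i + if (i <= r)%N then d else 0)%N | i < m].
have st : sorted geq t.
  apply/(sortedP 0%N) => i; rewrite size_tuple => im.
  have im' : (i < m)%N := ltnW im.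
  rewrite -(tnth_nth 0%N t (Ordinal im)) -(tnth_nth 0%N t (Ordinal im')) !tnth_mktuple /=.
  apply: leq_add; first exact: part_antitone.
  by case: leqP => // /ltnW ->.
by exists (exist _ t st) => i; rewrite {1}/part /= tnth_mktuple.
Qed.

Section Families.
Variables (k s : nat) (m : 'I_s -> nat).
Implicit Types (lam mu nu : partition_family m k) (h : 'I_k -> 'I_s -> nat).

Lemma family_inj mu nu :
  (forall l j i, part (mu l j) i = part (nu l j) i) -> mu = nu.
Proof.
by move=> e; apply/ffunP => l; apply/ffunP => j; apply: part_inj => i.
Qed.

Lemma raise_family (l0 : 'I_k) (j0 : 'I_s) (r d : nat) lam :
  exists lam', forall l j i, part (lam' l j) i =
    (part (lam l j) i + if [&& l == l0, j == j0 & i <= r] then d else 0)%N.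
Proof.
exists [ffun l => finfun (fun j =>
  sval (raise_partition r (if (l == l0) && (j == j0) then d else 0%N) (lam l j)))].
move=> l j i; rewrite !ffunE; case: raise_partition => nu /= ->.
by case: (l == l0); case: (j == j0); case: leqP.
Qed.

(* Parts are indexed from 0, so [h l j] is the number of parts already fixed. *)
Definition agree h nu : set (partition_family m k) :=
  [set mu : partition_family m k | forall l j (i : 'I_(m j)),
    (i < h l j)%N -> part (mu l j) i = part (nu l j) i].

(** Only the parts that [h] leaves free contribute: on [agree h nu] the factors of the others are
    constant and can be divided out. *)
Definition tail_exponent h lam mu (j : 'I_s) (l : 'I_k) : nat :=
  (\sum_(i < m j | h l j <= i) part (lam l j) i * part (mu l j) i)%N.

Definition tail_weight (R : realType) (p : 'I_s -> nat) h lam mu : R :=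
  \prod_(j < s) \prod_(l < k) (p j)%:R ^+ tail_exponent h lam mu j l.

Definition incr h (l0 : 'I_k) (j0 : 'I_s) : 'I_k -> 'I_s -> nat :=
  fun l j => (h l j + ((l == l0) && (j == j0)))%N.

(** This puts the next stage in the form of a fibre, as [fiber_determinacy] requires. *)
Lemma agree_incr h nu l0 j0 (i0 : 'I_(m j0)) : val i0 = h l0 j0 ->
  agree (incr h l0 j0) nu =
  agree h nu `&` (fun mu => part (mu l0 j0) i0) @^-1` [set part (nu l0 j0) i0].
Proof.
move=> i0h; apply/seteqP; split => [mu H|mu [H1 H2] l j i].
  split; last by apply: H; rewrite /incr !eqxx addn1 -i0h.
  by move=> l j i ih; apply: H; rewrite (leq_trans ih)// leq_addr.
rewrite /incr; have [ll0|_] := eqVneq l l0; last by rewrite addn0; exact: H1.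
have [jj0|_] := eqVneq j j0; last by rewrite addn0; exact: H1.
subst l j; rewrite addn1 ltnS leq_eqVlt => /orP[/eqP ih|]; last exact: H1.
by have -> : i = i0 by apply: val_inj; rewrite /= ih.
Qed.

(** Common core of [tail_weight_incr] and [tail_weight_raise], where the exponent changes at a
    single pair. *)
Lemma prod_expr_bump (R : realType) (q : 'I_s -> R) (E E' : 'I_s -> 'I_k -> nat)
    (j0 : 'I_s) (l0 : 'I_k) (e : nat) :
  (forall j l, E' j l = E j l + if (l == l0) && (j == j0) then e else 0)%N ->
  \prod_(j < s) \prod_(l < k) q j ^+ E' j l =
  \prod_(j < s) \prod_(l < k) q j ^+ E j l * q j0 ^+ e.
Proof.
move=> EE; under eq_bigr do under eq_bigr do rewrite EE exprD.
under eq_bigr do rewrite big_split.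
rewrite big_split /=; congr (_ * _).
rewrite (bigD1 j0)//= (bigD1 l0)//= !eqxx big1; last first.
  by move=> l /negbTE ->.
rewrite mulr1 big1 ?mulr1// => j /negbTE jj0.
by rewrite big1// => l _; rewrite jj0 andbF.
Qed.

Lemma tail_weight_incr (R : realType) p h lam mu l0 j0 (i0 : 'I_(m j0)) :
  val i0 = h l0 j0 ->
  tail_weight R p h lam mu = tail_weight R p (incr h l0 j0) lam mu
    * (p j0)%:R ^+ (part (lam l0 j0) i0 * part (mu l0 j0) i0).
Proof.
move=> i0h; apply: (@prod_expr_bump _ _ _ _ j0 l0) => j l; rewrite /tail_exponent /incr.
have [ll0|_] := eqVneq l l0; last by rewrite /= !addn0.
have [jj0|_] := eqVneq j j0; last by rewrite /= !addn0.
subst l j; rewrite (bigD1 i0) /= ?i0h// addnC addn1; congr (_ + _)%N.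
by apply: eq_bigl => i; rewrite ltn_neqAle andbC eq_sym -i0h.
Qed.

(** All entries up to [i0] are raised, but the tail starts exactly at [i0], so only [i0] contributes
    a new factor. *)
Lemma tail_weight_raise (R : realType) p h lam lam' mu l0 j0 (i0 : 'I_(m j0)) d :
  val i0 = h l0 j0 ->
  (forall l j i, part (lam' l j) i =
    (part (lam l j) i + if [&& l == l0, j == j0 & i <= i0] then d else 0)%N) ->
  tail_weight R p h lam' mu =
  tail_weight R p h lam mu * (p j0)%:R ^+ (d * part (mu l0 j0) i0).
Proof.
move=> i0h lamE; apply: (@prod_expr_bump _ _ _ _ j0 l0) => j l; rewrite /tail_exponent.
under eq_bigr do rewrite lamE mulnDl.
rewrite big_split /=; congr (_ + _)%N.
have [ll0|_] := eqVneq l l0; last by rewrite big1.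
have [jj0|_] := eqVneq j j0; last by rewrite big1.
subst l j; rewrite /= (bigD1 i0) /= ?i0h// leqnn big1 ?addn0// => i.
move=> /andP[hi ii0]; case: leqP => // ih; case/eqP: ii0.
by apply: val_inj; rewrite /= i0h; apply/eqP; rewrite eqn_leq ih hi.
Qed.

Lemma tail_weight_ge0 (R : realType) p h lam mu : 0 <= tail_weight R p h lam mu.
Proof. by apply: prodr_ge0 => j _; apply: prodr_ge0 => l _; rewrite exprn_ge0. Qed.

Lemma tail_weight_le (R : realType) p h h' lam mu :
  (forall j, 0 < p j)%N -> (forall l j, h' l j <= h l j)%N ->
  tail_weight R p h lam mu <= tail_weight R p h' lam mu.
Proof.
move=> p0 hh; apply: ler_prod => j _; rewrite prodr_ge0 => [|l _]; last by rewrite exprn_ge0.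
apply: ler_prod => l _; rewrite exprn_ge0//= ler_weXn2l ?ler1n//.
rewrite /tail_exponent [leqRHS](bigID (fun i : 'I_(m j) => h l j <= i)%N) /=.
rewrite (eq_bigl (fun i : 'I_(m j) => (h' l j <= i) && (h l j <= i)))%N ?leq_addr//.
by move=> i; case: leqP => // hi; rewrite ?andbF// (leq_trans (hh l j) hi).
Qed.

End Families.

(** * The growth bound and the induction on the number of fixed parts *)

Section Step.
Variables (R : realType) (k s : nat) (p m : 'I_s -> nat).
Implicit Types (lam mu nu : partition_family m k) (h : 'I_k -> 'I_s -> nat).

Definition growth (F a : R) lam : R :=
  \prod_(j < s) (F ^+ m j * (p j)%:R `^ (a *
    (\sum_(i < m j) (\sum_(l < k) part (lam l j) i) ^ 2)%N%:R)).

Lemma growth_ge0 F a lam : 0 <= F -> 0 <= growth F a lam.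
Proof.
by move=> F0; apply: prodr_ge0 => j _; rewrite mulr_ge0 ?exprn_ge0 ?powR_ge0.
Qed.

(** For the first part just one column sum [S] becomes [S + d], and expanding the square gives
    [a * d ^ 2 + 2 * a * S * d]. Raising [i0 + 1] columns would give the quadratic coefficient
    [a * (i0 + 1)], which may exceed [1 / 2]; hence the restriction to [i0 = 0]. *)
Lemma growth_raise F a lam lam' l0 j0 (i0 : 'I_(m j0)) d :
  (0 < p j0)%N -> val i0 = 0%N ->
  (forall l j i, part (lam' l j) i =
    (part (lam l j) i + if [&& l == l0, j == j0 & i <= i0] then d else 0)%N) ->
  growth F a lam' = growth F a lam *
    (p j0)%:R `^ (a * d%:R ^+ 2 + 2 * a * (\sum_(l < k) part (lam l j0) i0)%N%:R * d%:R).
Proof.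
move=> p0 i00 lamE.
have colE j (i : 'I_(m j)) : (\sum_(l < k) part (lam' l j) i =
    \sum_(l < k) part (lam l j) i + if (j == j0) && (i <= i0) then d else 0)%N.
  under eq_bigr do rewrite lamE.
  rewrite big_split /=; congr (_ + _)%N; rewrite (bigD1 l0)//= eqxx /= big1 ?addn0//.
  by move=> l /negbTE ->.
rewrite /growth (bigD1 j0)//= [in RHS](bigD1 j0)//= [RHS]mulrAC; congr (_ * _); last first.
  apply: eq_bigr => j /negbTE jj0; congr (_ * _ `^ (_ * _%:R)).
  by apply: eq_bigr => i _; rewrite colE jj0 addn0.
rewrite -[RHS]mulrA -powRD; last by rewrite pnatr_eq0 -lt0n p0 implybT.
congr (_ * _ `^ _); rewrite (bigD1 i0)//= [in RHS](bigD1 i0)//= colE eqxx leqnn /=.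
rewrite (eq_bigr (fun i => (\sum_(l < k) part (lam l j0) i) ^ 2))%N; last first.
  move=> i ii0; rewrite colE eqxx /= i00 leqn0 ifN ?addn0//.
  by apply: contra ii0 => /eqP i0E; apply/eqP/val_inj; rewrite /= i0E.
by rewrite !natrD !natrX natrD; ring.
Qed.

(** Restricting to [agree h nu] and dropping factors that are at least 1 can only decrease the
    sum. *)
Lemma tail_moments_fin h lam nu (x C : partition_family m k -> R) :
  (forall j, 0 < p j)%N -> (forall mu, 0 <= x mu) ->
  (\esum_(mu in [set: partition_family m k])
    (x mu * tail_weight R p (fun _ _ => 0) lam mu)%:E = (C lam)%:E)%E ->
  exists2 r : R, (\esum_(mu in agree h nu) (x mu * tail_weight R p h lam mu)%:E
    = r%:E)%E & r <= C lam.
Proof.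
move=> p0 x0 xC.
have le_C : (\esum_(mu in agree h nu) (x mu * tail_weight R p h lam mu)%:E
    <= (C lam)%:E)%E.
  rewrite -xC; apply: (le_trans (subset_le_esum _ (@subsetT _ _))).
  by apply: le_esum => mu _; rewrite lee_fin ler_wpM2l// tail_weight_le.
have fin : (\esum_(mu in agree h nu) (x mu * tail_weight R p h lam mu)%:E
    \is a fin_num)%E.
  rewrite ge0_fin_numE; first exact: le_lt_trans le_C (ltry _).
  by apply: esum_ge0 => mu _; rewrite lee_fin mulr_ge0// tail_weight_ge0.
by exists (fine (\esum_(mu in agree h nu) (x mu * tail_weight R p h lam mu)%:E));
  rewrite -?lee_fin fineK.
Qed.

(** The induction invariant. Quantifying over [lam] matters: raised versions of [lam] supply the
    moments of every order for the next part. *)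
Definition tail_agree (x y : partition_family m k -> R) h := forall lam nu,
  (\esum_(mu in agree h nu) (x mu * tail_weight R p h lam mu)%:E =
   \esum_(mu in agree h nu) (y mu * tail_weight R p h lam mu)%:E)%E.

Lemma tail_agree_incr (x y C : partition_family m k -> R) (F a : R) h l0 j0 :
  (forall j, 1 < p j)%N -> 0 <= F -> 0 <= a -> a < 1 / 2 ->
  (forall mu, 0 <= x mu) -> (forall mu, 0 <= y mu) ->
  (forall lam, \esum_(mu in [set: partition_family m k])
    (x mu * tail_weight R p (fun _ _ => 0) lam mu)%:E = (C lam)%:E)%E ->
  (forall lam, C lam <= growth F a lam) ->
  (h l0 j0 < m j0)%N ->
  tail_agree x y h -> tail_agree x y (incr h l0 j0).
Proof.
move=> p1 F0 a0 a12 x0 y0 xC CF hm xy lam nu.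
have p0 j : (0 < p j)%N by rewrite (leq_trans _ (p1 j)).
have q1 : 1 < (p j0)%:R :> R by rewrite ltr1n.
have q0 : 0 < (p j0)%:R :> R by rewrite ltr0n.
pose i0 := Ordinal hm.
have i0h : val i0 = h l0 j0 by [].
pose g mu := part (mu l0 j0) i0.
have /choice[lam_ lamE] d := raise_family l0 j0 i0 d lam.
have weightE d mu : tail_weight R p h (lam_ d) mu =
    tail_weight R p h lam mu * (p j0)%:R ^+ (d * g mu).
  exact: tail_weight_raise.
have /choice[M ME] d : exists r : R, (\esum_(mu in agree h nu)
    (x mu * tail_weight R p h (lam_ d) mu)%:E = r%:E)%E /\ r <= C (lam_ d).
  by have [r] := tail_moments_fin h nu p0 x0 (xC (lam_ d)); exists r.
have w0 (z : partition_family m k -> R) mu : (forall mu, 0 <= z mu) ->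
    0 <= z mu * tail_weight R p h lam mu.
  by move=> z0; rewrite mulr_ge0// tail_weight_ge0.
have [K [b [K0 MK]]] : exists K b : R, 0 <= K /\
    forall d, M d <= K * (p j0)%:R `^ (a * d%:R ^+ 2 + b * d%:R).
  have [h0|h_gt0] := posnP (h l0 j0).
    exists (growth F a lam), (2 * a * (\sum_(l < k) part (lam l j0) i0)%N%:R).
    split; first exact: growth_ge0.
    move=> d; apply: (le_trans (ME d).2); apply: (le_trans (CF _)).
    by rewrite (growth_raise F a (p0 j0) _ (lamE d)).
  have i1m : ((h l0 j0).-1 < m j0)%N by rewrite (leq_ltn_trans (leq_pred _)).
  pose B := part (nu l0 j0) (Ordinal i1m).
  (* On [agree h nu] the preceding part is fixed to [B] and bounds the part [i0], so [M d] is at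
     most [M 0] times [q ^ (d * B)], where [q] is [p j0]. The factor with exponent [a * d ^ 2] is at
     least 1, since [0 <= a], and is inserted to fit the common form. *)
  exists (M 0%N), B%:R; split.
    rewrite -lee_fin -(ME 0%N).1 esum_ge0// => mu _.
    by rewrite lee_fin mulr_ge0// tail_weight_ge0.
  move=> d; rewrite powRD; last by rewrite (gt_eqF q0) implybT.
  apply: (@le_trans _ _ ((p j0)%:R ^+ (d * B) * M 0%N)); last first.
    rewrite mulrC ler_wpM2l//.
      rewrite -lee_fin -(ME 0%N).1 esum_ge0// => mu _.
      by rewrite lee_fin mulr_ge0// tail_weight_ge0.
    rewrite -powR_mulrn ?ler0n// mulnC natrM ler_peMl ?powR_ge0//.
    by rewrite -[leLHS](powRr0 (p j0)%:R) ler_powR ?(ltW q1)// mulr_ge0// sqr_ge0.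
  rewrite -lee_fin EFinM -(ME d).1 -(ME 0%N).1 -esumZl ?exprn_ge0//; last first.
    by move=> mu; rewrite mulr_ge0// tail_weight_ge0.
  apply: le_esum => mu muS; rewrite lee_fin !weightE mul0n expr0 mulr1.
  rewrite mulrA [leRHS]mulrC ler_wpM2l ?w0//.
  rewrite ler_weXn2l ?(ltW q1)// leq_mul2l; apply/orP; right.
  have <- : part (mu l0 j0) (Ordinal i1m) = B by apply: muS; rewrite /= prednK.
  by apply: part_antitone; rewrite /= leq_pred.
have : (\esum_(mu in agree (incr h l0 j0) nu) (x mu * tail_weight R p h lam mu)%:E =
    \esum_(mu in agree (incr h l0 j0) nu) (y mu * tail_weight R p h lam mu)%:E)%E.
  rewrite (agree_incr nu i0h).
  apply: (fiber_determinacy (g := g) q1 K0 a12 _ _ _ _ MK) => [mu|mu|d|d].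
  - exact: w0.
  - exact: w0.
  - by rewrite -(ME d).1; apply: eq_esum => mu _; rewrite weightE mulrA.
  - by rewrite -(ME d).1 xy; apply: eq_esum => mu _; rewrite weightE mulrA.
(* The weight is still that of [h]. Once the part [i0] is fixed, its factor is a nonzero constant,
   to be pulled out and cancelled. *)
have scale (z : partition_family m k -> R) : (forall mu, 0 <= z mu) ->
    (\esum_(mu in agree (incr h l0 j0) nu) (z mu * tail_weight R p h lam mu)%:E =
     ((p j0)%:R ^+ (part (lam l0 j0) i0 * part (nu l0 j0) i0))%:E *
     \esum_(mu in agree (incr h l0 j0) nu)
       (z mu * tail_weight R p (incr h l0 j0) lam mu)%:E)%E.
  move=> z0; rewrite -esumZl ?exprn_ge0//; last first.
    by move=> mu; rewrite mulr_ge0// tail_weight_ge0.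
  apply: eq_esum => mu; rewrite (agree_incr nu i0h) => -[_ /= gmu].
  by rewrite (tail_weight_incr R p lam mu i0h) gmu mulrA mulrC.
rewrite !scale//.
move=> /(congr1 (mule ((p j0)%:R ^+ (part (lam l0 j0) i0 * part (nu l0 j0) i0))^-1%:E)).
by rewrite !muleA -!EFinM mulVf ?mul1e// expf_neq0// gt_eqF.
Qed.

Lemma tail_agree_of_moments (x y C : partition_family m k -> R) (F a : R) :
  (forall j, 1 < p j)%N -> 0 <= F -> 0 <= a -> a < 1 / 2 ->
  (forall mu, 0 <= x mu) -> (forall mu, 0 <= y mu) ->
  (forall lam, \esum_(mu in [set: partition_family m k])
    (x mu * tail_weight R p (fun _ _ => 0) lam mu)%:E = (C lam)%:E)%E ->
  (forall lam, \esum_(mu in [set: partition_family m k])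
    (y mu * tail_weight R p (fun _ _ => 0) lam mu)%:E = (C lam)%:E)%E ->
  (forall lam, C lam <= growth F a lam) ->
  forall h, (forall l j, h l j <= m j)%N -> tail_agree x y h.
Proof.
move=> p1 F0 a0 a12 x0 y0 xC yC CF h.
(* Induction on the total number of fixed parts; at 0, [agree] is the whole set and the hypotheses
   on the moments apply directly. *)
have [n hn] : exists n, (\sum_(l < k) \sum_(j < s) h l j = n)%N by eexists.
elim: n h hn => [|n IH] h hn hm.
  have -> : h = fun _ _ => 0%N.
    apply/funext => l; apply/funext => j; apply/eqP.
    move/eqP: hn; rewrite sum_nat_eq0 => /forallP/(_ l)/=.
    by rewrite sum_nat_eq0 => /forallP/(_ j).
  move=> lam nu; have -> : agree (fun _ _ => 0%N) nu = setT.
    by apply/seteqP; split.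
  by rewrite xC yC.
have [l0 [j0 h0]] : exists l0 j0, (0 < h l0 j0)%N.
  apply: contrapT => /forallNP hN; move: hn.
  rewrite big1 // => l _; apply: big1 => j _; apply/eqP.
  by rewrite -leqn0 leqNgt; apply/negP => hlj; apply: (hN l); exists j.
(* One part is released at a pair with [0 < h l0 j0], so the truncated subtraction is exact and
   [incr] undoes it. *)
pose h' l j := (h l j - ((l == l0) && (j == j0)))%N.
have hE : h = incr h' l0 j0.
  apply/funext => l; apply/funext => j; rewrite /incr /h' subnK//.
  by have [->|//] := eqVneq l l0; have [->|//] := eqVneq j j0.
have hm' l j : (h' l j <= m j)%N by rewrite (leq_trans (leq_subr _ _)).
rewrite hE; apply: (tail_agree_incr p1 F0 a0 a12 x0 y0 xC CF).
  by rewrite (leq_trans _ (hm l0 j0))// hE /incr !eqxx addn1.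
apply: IH => //; apply/eqP; rewrite -eqSS -hn hE /incr.
under [X in _ == X]eq_bigr do rewrite big_split /=.
rewrite big_split /= -addn1 eqn_add2l (bigD1 l0)//= (bigD1 j0)//= !eqxx.
rewrite big1 => [|j /negbTE -> //]; rewrite big1 // => l /negbTE ->.
by rewrite big1.
Qed.

End Step.

Theorem theorem9p3 (R : realType) (k s : nat) (p m : 'I_s -> nat)
    (hk : (1 <= k)%N)
    (p_inj : injective p) (p_prime : forall j : 'I_s, prime (p j))
    (hm : forall j : 'I_s, (1 <= m j)%N)
    (x y : partition_family m k -> R)
    (x_ge0 : forall mu : partition_family m k, 0 <= x mu)
    (y_ge0 : forall mu : partition_family m k, 0 <= y mu)
    (C : partition_family m k -> R)
    (x_moment : forall lambda : partition_family m k,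
      (\esum_(mu in [set: partition_family m k])
        (x mu * \prod_(j < s) \prod_(l < k)
           (p j)%:R ^+ (\sum_(i < m j)
             part (lambda l j) i * part (mu l j) i)%N)%:E = (C lambda)%:E)%E)
    (y_moment : forall lambda : partition_family m k,
      (\esum_(mu in [set: partition_family m k])
        (y mu * \prod_(j < s) \prod_(l < k)
           (p j)%:R ^+ (\sum_(i < m j)
             part (lambda l j) i * part (mu l j) i)%N)%:E = (C lambda)%:E)%E)
    (F c : R) (F_gt0 : 0 < F) (c_gt0 : 0 < c) (c_lt1 : c < 1)
    (C_growth : forall lambda : partition_family m k,
      C lambda <= \prod_(j < s) (F ^+ m j *
        (p j)%:R `^ ((1 - c) / 2 *
          (\sum_(i < m j) (\sum_(l < k) part (lambda l j) i) ^ 2)%N%:R))) :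
  forall mu : partition_family m k, x mu = y mu.
Proof.
move=> mu.
have p1 j : (1 < p j)%N := prime_gt1 (p_prime j).
have a0 : 0 <= (1 - c) / 2 by lra.
have a12 : (1 - c) / 2 < 1 / 2 by lra.
(* With [h = 0] the condition [0 <= i] computes to [true], so the moment hypotheses match
   [tail_weight] by conversion. The conclusion is taken with every part fixed. *)
have := tail_agree_of_moments p1 (ltW F_gt0) a0 a12 x_ge0 y_ge0
  x_moment y_moment C_growth (fun _ j => leqnn (m j)) mu mu.
(* Both sums now have the single index [mu], whose remaining weight is an empty product. *)
have -> : agree (fun _ j => m j) mu = [set mu].
  apply/seteqP; split => [nu nuE|nu -> //].
  by apply: family_inj => l j i; rewrite nuE.
have weight1 : tail_weight R p (fun _ j => m j) mu mu = 1.
  rewrite /tail_weight big1// => j _; rewrite big1// => l _.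
  by rewrite /tail_exponent big_pred0 ?expr0// => i; rewrite leqNgt ltn_ord.
by rewrite !esum_set1 weight1 ?mulr1 ?lee_fin// => -[].
Qed.
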